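(* Let $A\in\mathbb{R}^{n\times n}$ have simple spectrum $\sigma(A)=\{\lambda_1,\dots,\lambda_n\}$ (distinct eigenvalues) such that $\lambda_i+\lambda_j\ne0$ for all $\lambda_i,\lambda_j\in\sigma(A)$, and let $b\in\mathbb{R}^n$ be such that the matrix $\mathcal{C}=[b,Ab,\dots,A^{n-1}b]$ is non-singular. Then the (invertible) solution $P^{-1}$ of the Riccati equation $$P^{-1}A+A^*P^{-1}=-P^{-1}bb^TP^{-1}$$ has the following spectral decompositions into Hermitian matrices corresponding to individual eigenvalues or to their pairwise combinations: $$P^{-1}=\sum_{j=1}^n(\mathcal{C}^T)^{-1}\mathcal{H}_u^{-1}\tilde P_j^{-C}\mathcal{H}_u^{-1}\mathcal{C}^{-1},\qquad P^{-1}=\sum_{i,j=1}^n(\mathcal{C}^T)^{-1}\mathcal{H}_u^{-1}P_{ij}^{-C}\mathcal{H}_u^{-1}\mathcal{C}^{-1},$$ where $$\tilde P_j^{-C}=\left\{\frac{N(-\lambda_j)}{-N'(\lambda_j)}\mathcal{J}y_jy_j^T\right\}_H,\qquad P_{ij}^{-C}=\left\{\frac{N(-\lambda_i^* )N(-\lambda_j)}{-N'(\lambda_i^* )N'(\lambda_j)}\cdot\frac{(y_i^* )^Ty_j^T}{\lambda_i^*+\lambda_j}\right\}_H .$$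
   Context: $N(s)=\det(sI-A)=\sum_{k=0}^na_ks^k$ with $a_n=1$ is the characteristic polynomial of $A$. $\mathcal{H}_u$ is the $n\times n$ upper Hankel matrix with entries $(\mathcal{H}_u)_{rc}=a_{r+c-1}$ if $r+c\le n+1$ and $0$ otherwise (first row $a_1,a_2,\dots,a_{n-1},1$). $x_j=[1,\lambda_j,\dots,\lambda_j^{n-1}]^T$ and $y_j=\lambda_j^{-n}\mathcal{H}_lx_j$, where $\mathcal{H}_l$ is the $n\times n$ lower Hankel matrix with $(\mathcal{H}_l)_{rc}=a_{r+c-n-1}$ if $r+c\ge n+1$ and $0$ otherwise. $\mathcal{J}=\mathrm{diag}(-1,(-1)^2,\dots,(-1)^n)$. $(\cdot)^*$ is the complex conjugate transpose (conjugate for scalars), so $(y_i^* )^T$ is the column vector of conjugates of the entries of $y_i$; $\{M\}_H=\tfrac12(M+M^* )$ is the Hermitian part. The notation $P^{-1}$ indicates that the unknown of the Riccati equation is an invertible matrix. *)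

(* Defs.v *)
From mathcomp Require Export all_boot all_order all_algebra.
From mathcomp Require Export complex.

Export GRing.Theory Num.Theory.

#[export] Set Implicit Arguments.
#[export] Unset Strict Implicit.
#[export] Unset Printing Implicit Defensive.

Global Open Scope ring_scope.
Global Open Scope complex_scope.
Global Open Scope sesquilinear_scope.

(* All indices start at 0, so row r and column c of the 1-based definitions are
   i = r - 1 and j = c - 1. *)

Definition ctrb (R : comNzRingType) (n : nat) (A : 'M[R]_n) (b : 'cV[R]_n) :
    'M[R]_n :=
  \matrix_(i < n, j < n) (A ^+ j *m b) i 0.

(* a_(r+c-1) if r + c <= n + 1, and 0 otherwise *)
Definition upper_hankel (R : nzRingType) (n : nat) (N : {poly R}) : 'M[R]_n :=
  \matrix_(i < n, j < n) (if (i + j < n)%N then N`_(i + j).+1 else 0).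

(* a_(r+c-n-1) if r + c >= n + 1, and 0 otherwise; the subtraction is only
   evaluated where it is not truncated *)
Definition lower_hankel (R : nzRingType) (n : nat) (N : {poly R}) : 'M[R]_n :=
  \matrix_(i < n, j < n)
    (if (n <= (i + j).+1)%N then N`_((i + j).+1 - n) else 0).

(* diag(-1, (-1)^2, ..., (-1)^n) *)
Definition alt_diag (R : nzRingType) (n : nat) : 'M[R]_n :=
  diag_mx (\row_(i < n) (-1) ^+ i.+1).

Definition herm_part (C : numClosedFieldType) (n : nat) (M : 'M[C]_n) :
    'M[C]_n :=
  2^-1 *: (M + M ^t*).

Definition xvec (R : nzRingType) (n : nat) (l : R) : 'cV[R]_n :=
  \col_(i < n) l ^+ i.

Section SpectralTerms.
Variables (C : numClosedFieldType) (n : nat) (A : 'M[C]_n).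

Let N := char_poly A.

Definition yvec (l : C) : 'cV[C]_n :=
  l ^- n *: (lower_hankel n N *m xvec n l).

Definition Ptilde (l : C) : 'M[C]_n :=
  herm_part ((N.[- l] / - N^`().[l]) *:
               (alt_diag C n *m yvec l *m (yvec l)^T)).

Definition Ppair (l m : C) : 'M[C]_n :=
  herm_part (((N.[- l^*] * N.[- m]) / (- N^`().[l^*] * N^`().[m])) *:
               ((l^* + m)^-1 *: ((yvec l ^t*)^T *m (yvec m)^T))).

(* The transformation of a term from controllability canonical form back to
   the original coordinates. *)
Definition from_canonical (b : 'cV[C]_n) (M : 'M[C]_n) : 'M[C]_n :=
  invmx (ctrb A b)^T *m invmx (upper_hankel n N) *m M
    *m invmx (upper_hankel n N) *m invmx (ctrb A b).

Definition riccati (b : 'cV[C]_n) (X : 'M[C]_n) : Prop :=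
  X *m A + A ^t* *m X = - (X *m b *m b^T *m X).

End SpectralTerms.

(* Main.v *)
Require Import Defs.
From mathcomp Require Import ring zify.

(** Write N for the characteristic polynomial, H for the upper Hankel matrix of
its coefficients, K for the controllability matrix, x_l for the column of
powers of l, and J for the alternating diagonal.  Everything rests on the
Bezoutian identity
  x_s^T H x_t (s - t) = N(s) - N(t)
([bezout_form]), which says that H is the coefficient matrix of the
divided difference of N.

On an eigenvalue l, the identity N(l) = 0 turns the lower Hankel vector y_l
into - H x_l ([yvec_upper_hankel]).  Hence the change of basis
K^-T H^-1 sends y_l to u_l = - K^-T x_l, and by Cayley-Hamilton u_l is a left
eigenvector of A ([ctrb_lefteig]), normalised by u_l^T b = - 1
([lefteig_b]).  At two distinct eigenvalues the Bezoutian vanishes, and at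
a repeated one it is N'(l): the Vandermonde matrix V satisfies
V^T H V = diag(N'(l_j)), so V and H are invertible, and the y_l form a basis
dual to the x_l up to the factors - N'(l).  Expanding J y_m in that basis, with
coefficients read off from the Bezoutian at (- l_i, m), gives
  J y_m = sum_i c_i / (l_i + m) y_i,   c_i = N(- l_i) / N'(l_i)
([yvec_expansion]).

Consequently sum_j - c_j J y_j y_j^T is the same matrix as
sum_(i, j) - c_i c_j / (l_i + l_j) y_i y_j^T.  Call X its transport to the
original coordinates.  The first form is a product of invertible matrices, so
X is invertible.  The second form is an expansion in dyads u_i u_j^T of left
eigenvectors, so the Lyapunov operator multiplies each coefficient by
l_i + l_j, and X A + A^T X = - w w^T with w = sum_i c_i u_i.  The last
coordinate of the expansion of J y_m shows X b = +- w, whence the Riccati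
equation ([riccati_solP]).

If X is an invertible solution, X^-1 solves a linear Lyapunov equation, whose
entries in the basis of the u_i are forced ([lyapunov_entry]); hence uniqueness.
Since A and b are real, the adjoint of a solution is a solution, so X is
Hermitian by uniqueness.  The Hermitian part is additive and commutes with the
real change of basis, so it may be dropped from both sums once they are
completed.  In the double sum, the first index carries conjugated eigenvalues;
there the conjugate of the expansion of J y at the eigenvalue conjugate to
l_j takes the place of the expansion at l_j ([conj_yvec_expansion]). *)

(** * The Bezoutian of a polynomial and its Hankel matrix *)

Section Bezout.
Variables (R : comNzRingType) (n : nat) (N : {poly R}).
Local Notation H := (upper_hankel n N).

Lemma trmx_upper_hankel : H^T = H.
Proof. by apply/matrixP => i j; rewrite !mxE addnC. Qed.

Lemma horner_drop_polyS k (t : R) :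
  (drop_poly k N).[t] = N`_k + (drop_poly k.+1 N).[t] * t.
Proof.
have -> : drop_poly k N = (N`_k)%:P + drop_poly k.+1 N * 'X.
  apply/polyP => -[|i]; rewrite coefD coefMX coefC !coef_drop_poly /= ?add0n ?addr0 //.
  by rewrite add0r addSnnS.
by rewrite hornerD hornerMX hornerC.
Qed.

Hypothesis sizeN : (size N <= n.+1)%N.

(** A row of the Hankel matrix lists the coefficients of N from some degree
upwards, that is, those of a truncation of N. *)
Lemma upper_hankel_xvec (t : R) (k : 'I_n) :
  (H *m xvec n t) k 0 = (drop_poly k.+1 N).[t].
Proof.
rewrite mxE (@horner_coef_wide _ (n - k)); last first.
  by rewrite size_drop_poly leq_subLR addSn subnKC // ltnW.
rewrite [LHS](eq_bigr (fun j : 'I_n =>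
  if (j < n - k)%N then N`_(k + j).+1 * t ^+ j else 0)).
  rewrite -big_mkcond.
  rewrite (big_ord_widen n (fun j => (drop_poly k.+1 N)`_j * t ^+ j)) ?leq_subr //.
  by apply: eq_bigr => j _; rewrite coef_drop_poly addnS addnC.
by move=> j _; rewrite !mxE ltn_subRL; case: ifP; rewrite ?mul0r.
Qed.

(** The divided difference (N(s) - N(t)) / (s - t) as a polynomial in s; its
coefficients are the partial values of Horner's scheme for N at t. *)
Definition bezout_quotient (t : R) : {poly R} :=
  \poly_(k < n) (drop_poly k.+1 N).[t].

Lemma bezout_quotientP (t : R) :
  bezout_quotient t * ('X - t%:P) = N - N.[t]%:P.
Proof.
have Nt : N.[t] = N`_0 + (drop_poly 1 N).[t] * t.
  by rewrite -horner_drop_polyS drop_poly0l.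
have drop0 k : (n <= k)%N -> (drop_poly k.+1 N).[t] = 0.
  by move=> nk; rewrite drop_poly_eq0 ?horner0 // (leq_trans sizeN).
apply/polyP => -[|k]; rewrite mulrBr !coefB coefMX coefMC coefC !coef_poly /=.
  rewrite Nt opprD addrA subrr !sub0r.
  by case: posnP => // n0; rewrite mul0r drop0 ?n0 ?mul0r ?oppr0.
rewrite subr0; have [kn|nk] := ltnP k n; last first.
  by rewrite ltnNge (leq_trans nk) //= mul0r subr0 nth_default // (leq_trans sizeN).
rewrite horner_drop_polyS; case: ltnP => [_|nk]; first by rewrite addrK.
by rewrite (drop0 k.+1) // mul0r addr0 subr0.
Qed.

Lemma bezout_quotientE (s t : R) :
  ((xvec n s)^T *m H *m xvec n t) 0 0 = (bezout_quotient t).[s].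
Proof.
rewrite horner_poly -mulmxA mxE; apply: eq_bigr => k _.
by rewrite upper_hankel_xvec mulrC !mxE.
Qed.

Lemma bezout_form (s t : R) :
  ((xvec n s)^T *m H *m xvec n t) 0 0 * (s - t) = N.[s] - N.[t].
Proof.
have := congr1 (fun p => p.[s]) (bezout_quotientP t).
by rewrite bezout_quotientE hornerM !hornerE.
Qed.

(** Differentiating (s - t) q(s) = N(s) - N(t) at s = t leaves q(t) = N'(t). *)
Lemma bezout_form_diag (t : R) :
  ((xvec n t)^T *m H *m xvec n t) 0 0 = N^`().[t].
Proof.
have := congr1 (fun p => p^`().[t]) (bezout_quotientP t).
rewrite bezout_quotientE derivM !derivB !derivX !derivC !subr0 mulr1.
by rewrite !hornerE subrr mulr0 add0r.
Qed.
End Bezout.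

(** The entry k of y_l is l^(-k-1) times the value at l of the part of N of
degree at most k; as N(l) = 0, that value is minus the value of the remaining
part, which is l^(k+1) times the entry k of H x_l. *)
Lemma yvec_upper_hankel (C : numClosedFieldType) n (A : 'M[C]_n) (l : C) :
  root (char_poly A) l -> l != 0 ->
  yvec A l = - (upper_hankel n (char_poly A) *m xvec n l).
Proof.
set N := char_poly A => /rootP Nl l0; apply/colP => k.
have sizeN : (size N <= n.+1)%N by rewrite size_char_poly.
rewrite mxE [RHS]mxE upper_hankel_xvec //.
have -> : (lower_hankel n N *m xvec n l) k 0
        = l ^+ (n - k.+1) * (take_poly k.+1 N).[l].
  rewrite mxE (@horner_coef_wide _ k.+1) ?size_take_poly // mulr_sumr.
  (* Both sums are reversed so that they run over the same index k - m. *)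
  rewrite (reindex_inj rev_ord_inj) [RHS](reindex_inj rev_ord_inj) /=.
  rewrite (big_ord_widen n (fun i => l ^+ (n - k.+1) *
    ((take_poly k.+1 N)`_(k.+1 - i.+1) * l ^+ (k.+1 - i.+1)))) //.
  rewrite [RHS]big_mkcond; apply: eq_bigr => i _.
  rewrite !mxE coef_take_poly subSS (ltnS (k - i)) leq_subr /= -addnS -subSn // subSS.
  have -> : (n <= k + (n - i))%N = (i < k.+1)%N by have := ltn_ord i; lia.
  case: ltnP => ik; last by rewrite mul0r.
  rewrite mulrCA -exprD; congr (N`_ _ * l ^+ _);
    have := ltn_ord i; have := ltn_ord k; lia.
have := poly_take_drop k.+1 N => /(congr1 (fun p => p.[l])).
rewrite hornerD hornerM hornerXn Nl => /eqP; rewrite addr_eq0 => /eqP ->.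
rewrite !mulrN mulrC [l ^+ _ * _]mulrCA -exprD subnK //.
by rewrite mulfK ?expf_neq0.
Qed.

(** * Conjugation and Hermitian parts *)

Lemma map_ctrb (R S : comNzRingType) (f : {rmorphism R -> S}) n
    (A : 'M[R]_n.+1) (b : 'cV[R]_n.+1) :
  map_mx f (ctrb A b) = ctrb (map_mx f A) (map_mx f b).
Proof.
apply/matrixP => i j; rewrite [RHS]mxE -rmorphXn -map_mxM.
by rewrite [LHS]mxE [RHS]mxE [ctrb _ _ _ _]mxE.
Qed.

Section Conjugation.
Variables (C : numClosedFieldType) (n : nat).
Implicit Types M : 'M[C]_n.

Lemma conj_realP m p (M : 'M[C]_(m, p)) : map_mx Num.conj M = M -> M ^t* = M^T.
Proof. by rewrite -map_trmx => ->. Qed.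

Lemma herm_part_hermsym M : herm_part M \is hermsymmx.
Proof.
apply/is_hermitianmxP; rewrite expr0 scale1r /herm_part.
rewrite [in RHS]linearZ [in RHS]linearD /=.
rewrite map_mxZ map_mxD -!map_trmx trmxK -map_mx_comp.
rewrite (map_mx_id (@conjCK C)) addrC; congr (_ *: _).
by rewrite fmorphV rmorph_nat.
Qed.

Lemma herm_part_id M : M ^t* = M -> herm_part M = M.
Proof.
move=> MH; rewrite /herm_part MH -mulr2n -scaler_nat scalerA mulVf ?scale1r //.
by rewrite pnatr_eq0.
Qed.

Lemma herm_part_sum (I : finType) (F : I -> 'M[C]_n) :
  herm_part (\sum_i F i) = \sum_i herm_part (F i).
Proof. by rewrite /herm_part linear_sum raddf_sum -big_split scaler_sumr. Qed.

Lemma herm_part_congr (L M : 'M[C]_n) :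
  map_mx Num.conj L = L -> herm_part (L *m M *m L^T) = L *m herm_part M *m L^T.
Proof.
move=> Lreal; rewrite /herm_part !trmx_mul trmxK !map_mxM (conj_realP Lreal) Lreal.
by rewrite -scalemxAr -scalemxAl mulmxDr mulmxDl !mulmxA.
Qed.

Variables (A : 'M[C]_n).
Hypothesis A_real : map_mx Num.conj A = A.
Local Notation N := (char_poly A).

Lemma char_poly_conj : map_poly Num.conj N = N.
Proof. by rewrite map_char_poly A_real. Qed.

Lemma horner_char_poly_conj z : N.[z^*] = (N.[z]^*)%R.
Proof. by rewrite -{1}char_poly_conj horner_map. Qed.

Lemma horner_deriv_char_poly_conj z : N^`().[z^*] = (N^`().[z]^*)%R.
Proof. by rewrite -{1}char_poly_conj deriv_map horner_map. Qed.

Lemma yvec_conj l : map_mx Num.conj (yvec A l) = yvec A (l^*)%R.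
Proof.
rewrite /yvec map_mxZ map_mxM fmorphV rmorphXn; congr (_ *: (_ *m _)).
  apply/matrixP => i j; rewrite !mxE; case: ifP => _; last by rewrite rmorph0.
  by rewrite -{2}char_poly_conj coef_map.
by apply/colP => i; rewrite !mxE rmorphXn.
Qed.

Lemma upper_hankel_conj : map_mx Num.conj (upper_hankel n N) = upper_hankel n N.
Proof.
apply/matrixP => i j; rewrite !mxE; case: ifP => _; last by rewrite rmorph0.
by rewrite -{2}char_poly_conj coef_map.
Qed.

Lemma alt_diag_conj : map_mx Num.conj (alt_diag C n) = alt_diag C n.
Proof.
by rewrite map_diag_mx; congr diag_mx; apply/rowP => i; rewrite !mxE rmorphXn rmorphN1.
Qed.
End Conjugation.

(** * Spectral data of a controllable pair *)

Lemma mulmx_entry_col (R : nzRingType) m n p (M : 'M[R]_(m, n)) (B : 'M_(n, p)) i k :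
  (M *m B) i k = (M *m col k B) i 0.
Proof. by rewrite [RHS]mxE mxE; apply: eq_bigr => j _; rewrite [in RHS]mxE. Qed.

Section Spectrum.
Variables (C : numClosedFieldType) (n' : nat).
Local Notation n := n'.+1.
Variables (A : 'M[C]_n) (b : 'cV[C]_n) (lambda : 'I_n -> C).
Local Notation N := (char_poly A).
Local Notation H := (upper_hankel n N).
Local Notation J := (alt_diag C n).

Definition vander : 'M[C]_n := Vandermonde n (\row_j lambda j).

(** The residue at l of N(- s) / N(s), for a simple root l of N. *)
Definition residue (l : C) : C := N.[- l] / N^`().[l].

(** The image of y_l in the original coordinates; see [lefteig_yvec]. *)
Definition lefteig (l : C) : 'cV[C]_n := - ((invmx (ctrb A b))^T *m xvec n l).

Lemma col_ctrb k : col k (ctrb A b) = A ^+ k *m b.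
Proof. by apply/colP => i; rewrite !mxE. Qed.

Lemma col_vander j : col j vander = xvec n (lambda j).
Proof. by apply/colP => i; rewrite !mxE. Qed.

Hypothesis ctrb_unit : ctrb A b \in unitmx.

(** Modulo sign, u_l^T = x_l^T K^-1 maps A^k b to l^k for k < n, because A^k b
is a column of K; Cayley-Hamilton and N(l) = 0 extend this to k = n.  So
u_l^T A and l u_l^T agree on the columns of K, which form a basis. *)
Lemma ctrb_lefteig (l : C) : root N l -> (lefteig l)^T *m A = l *: (lefteig l)^T.
Proof.
move=> Nl; rewrite /lefteig linearN /= trmx_mul trmxK.
set w := _ *m invmx _; have wC : w *m ctrb A b = (xvec n l)^T by rewrite mulmxKV.
rewrite mulNmx scalerN; congr (- _).
have wA k : (k < n)%N -> (w *m (A ^+ k *m b)) 0 0 = l ^+ k.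
  by move=> kn; rewrite -(col_ctrb (Ordinal kn)) -mulmx_entry_col wC !mxE.
have wAn : (w *m (A ^+ n *m b)) 0 0 = l ^+ n.
  have sizeN : size N = n.+1 by rewrite size_char_poly.
  have lead1 : N`_n = 1.
    by have /monicP := char_poly_monic A; rewrite /lead_coef sizeN.
  have : (w *m (horner_mx A N *m b)) 0 0 = N.[l].
    by rewrite Cayley_Hamilton mul0mx mulmx0 mxE (rootP Nl).
  rewrite -[X in horner_mx A X]coefK poly_def linear_sum /= mulmx_suml mulmx_sumr summxE.
  rewrite horner_coef sizeN big_ord_recr [RHS]big_ord_recr /= lead1 mul1r scale1r.
  under eq_bigr => i _.
    rewrite linearZ /= rmorphXn /= horner_mx_X -scalemxAl -scalemxAr mxE wA //.
    over.
  by rewrite rmorphXn /= horner_mx_X => /addrI.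
apply: (can_inj (mulmxK ctrb_unit)); rewrite -scalemxAl wC.
apply/rowP => k; rewrite [RHS]mxE [(xvec _ _)^T _ _]mxE [xvec _ _ _ _]mxE -exprS.
have <- : (w *m (A ^+ k.+1 *m b)) 0 0 = l ^+ k.+1.
  by have := ltn_ord k; rewrite leq_eqVlt => /predU1P[->|/wA].
by rewrite mulmx_entry_col col_ctrb exprS -!mulmxA.
Qed.

Lemma lefteig_b (l : C) : (lefteig l)^T *m b = (-1)%:M.
Proof.
have cb : ctrb A b *m delta_mx 0 0 = b.
  by rewrite -colE col_ctrb expr0 mul1mx.
rewrite -[X in _ *m X]cb /lefteig linearN /= trmx_mul trmxK mulNmx mulmxA mulmxKV //.
by apply/rowP => i; rewrite ord1 -colE !mxE expr0.
Qed.

Lemma from_canonicalE (M : 'M[C]_n) (L := (invmx (ctrb A b))^T *m invmx H) :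
  from_canonical A b M = L *m M *m L^T.
Proof.
by rewrite /from_canonical /L trmx_mul trmxK !trmx_inv trmx_upper_hankel !mulmxA.
Qed.

Hypothesis lambda_inj : injective lambda.
Hypothesis root_lambda : forall z, root N z <-> exists j, z = lambda j.
Hypothesis sum_neq0 : forall i j, lambda i + lambda j != 0.

Let rootN j : root N (lambda j).
Proof. by apply/root_lambda; exists j. Qed.

Lemma lambda_neq0 j : lambda j != 0.
Proof. by have := sum_neq0 j j; apply: contraNneq => ->; rewrite addr0. Qed.

Lemma deriv_char_poly_neq0 j : N^`().[lambda j] != 0.
Proof.
have -> : N = \prod_k ('X - (lambda k)%:P).
  have := @all_roots_prod_XsubC _ N [seq lambda k | k <- enum 'I_n].
  rewrite (monicP (char_poly_monic A)) scale1r size_char_poly size_map size_enum_ord.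
  rewrite uniq_rootsE map_inj_uniq // enum_uniq big_map big_enum; apply => //.
  by apply/allP => _ /mapP[k _ ->].
rewrite (bigD1 j) //= derivM hornerD !hornerM derivXsubC hornerXsubC subrr mul0r.
rewrite addr0 hornerC mul1r horner_prod; apply/prodf_neq0 => k kj.
by rewrite hornerXsubC subr_eq0 (inj_eq lambda_inj) eq_sym.
Qed.

Lemma char_polyN_neq0 j : N.[- lambda j] != 0.
Proof.
apply/negP => /root_lambda[k jk]; have := sum_neq0 j k.
by rewrite -jk subrr eqxx.
Qed.

(** The eigenvalues are roots of N, so the Bezoutian vanishes off the diagonal. *)
Lemma vander_congruence :
  vander^T *m H *m vander = diag_mx (\row_j N^`().[lambda j]).
Proof.
apply/matrixP => i j.
have -> : (vander^T *m H *m vander) i j =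
          ((xvec n (lambda i))^T *m H *m xvec n (lambda j)) 0 0.
  rewrite [LHS]mulmx_entry_col col_vander -!mulmxA.
  by rewrite -(col_vander i) tr_col -row_mul [RHS]mxE.
have sizeN : (size N <= n.+1)%N by rewrite size_char_poly.
rewrite [RHS]mxE [(\row__ _) _ _]mxE.
case: eqVneq => [<-|ij]; first by rewrite bezout_form_diag.
have := bezout_form sizeN (lambda i) (lambda j).
rewrite !(rootP (rootN _)) subrr => /eqP; rewrite mulf_eq0 => /predU1P[-> //|].
by rewrite subr_eq0 (inj_eq lambda_inj) (negPf ij).
Qed.

Lemma vander_hankel_unit : vander \in unitmx /\ H \in unitmx.
Proof.
have : vander^T *m H *m vander \in unitmx.
  rewrite vander_congruence unitmxE det_diag unitfE; apply/prodf_neq0 => j _.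
  by rewrite mxE deriv_char_poly_neq0.
by rewrite !unitmx_mul => /andP[/andP[]].
Qed.

(** Since V^T is invertible, it is enough to pair both sides with each x_i.  On
the left only the term y_i survives, by the duality [vander_congruence].  On the
right, x_i^T J = - x(- l_i)^T, so the pairing is the Bezoutian at (- l_i, mu),
where N(mu) = 0. *)
Lemma yvec_expansion mu : root N mu ->
  \sum_i (residue (lambda i) / (lambda i + mu)) *: yvec A (lambda i) =
  J *m yvec A mu.
Proof.
move=> Nmu.
have mu0 : mu != 0 by have /root_lambda[j ->] := Nmu; apply: lambda_neq0.
have [Vunit Hunit] := vander_hankel_unit.
apply: (can_inj (mulKmx (_ : vander^T \in unitmx))); first by rewrite unitmx_tr.
have xJ s : (xvec n s)^T *m J = - (xvec n (- s))^T.
  rewrite mul_mx_diag; apply/rowP => k; rewrite !mxE.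
  by rewrite exprSr mulrN1 mulrN (exprNn s) mulrC.
have rowV M i : (vander^T *m M) i 0 = ((xvec n (lambda i))^T *m M) 0 0 :> C.
  by rewrite -(col_vander i) tr_col -row_mul [RHS]mxE.
apply/colP => i; rewrite [RHS]rowV mulmxA xJ.
rewrite yvec_upper_hankel // mulNmx mulmxN opprK mulmxA.
have sizeN : (size N <= n.+1)%N by rewrite size_char_poly.
have lmu : lambda i + mu != 0 by have /root_lambda[j ->] := Nmu.
have /(canRL (mulfK _)) -> := bezout_form sizeN (- lambda i) mu; last first.
  by rewrite -opprD oppr_eq0.
rewrite (rootP Nmu) subr0.
rewrite rowV mulmx_sumr summxE (bigD1 i) //= big1 ?addr0 => [|j ji].
  rewrite -scalemxAr mxE yvec_upper_hankel ?lambda_neq0 // mulmxN mulmxA mxE.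
  rewrite bezout_form_diag // /residue; field.
  by rewrite deriv_char_poly_neq0 lmu addrC -opprD oppr_eq0 addrC lmu.
rewrite -scalemxAr mxE yvec_upper_hankel ?lambda_neq0 // mulmxN mulmxA mxE.
have := vander_congruence => /(congr1 (fun M : 'M[C]_n => M i j)).
rewrite [LHS]mulmx_entry_col col_vander -!mulmxA rowV => ->.
by rewrite !mxE eq_sym (negPf ji) oppr0 mulr0.
Qed.

Lemma lefteig_yvec l (L := (invmx (ctrb A b))^T *m invmx H) :
  root N l -> l != 0 -> L *m yvec A l = lefteig l.
Proof.
move=> Nl l0; have [_ Hunit] := vander_hankel_unit.
by rewrite yvec_upper_hankel // mulmxN mulmxA mulmxKV.
Qed.

(** * The solution of the Riccati equation *)

Definition canonical_sol : 'M[C]_n :=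
  \sum_j (- residue (lambda j)) *: (J *m yvec A (lambda j) *m (yvec A (lambda j))^T).

Definition riccati_sol : 'M[C]_n := from_canonical A b canonical_sol.

Definition pair_coef i j : C :=
  - (residue (lambda i) * residue (lambda j) / (lambda i + lambda j)).

Lemma pair_coefC i j : pair_coef i j = pair_coef j i.
Proof. by rewrite /pair_coef addrC [residue _ * _]mulrC. Qed.

(** Replace each J y_j in the single sum by its expansion. *)
Lemma riccati_sol_pairs :
  riccati_sol =
  \sum_i \sum_j pair_coef i j *: (lefteig (lambda i) *m (lefteig (lambda j))^T).
Proof.
rewrite /riccati_sol from_canonicalE /canonical_sol mulmx_sumr mulmx_suml exchange_big.
apply: eq_bigr => j _.
rewrite -yvec_expansion // mulmx_suml scaler_sumr mulmx_sumr mulmx_suml.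
apply: eq_bigr => i _.
rewrite -!lefteig_yvec ?lambda_neq0 // !trmx_mul.
move: (yvec A (lambda i)) (yvec A (lambda j)) => p q.
rewrite -!scalemxAl -!scalemxAr -!scalemxAl !mulmxA scalerA /pair_coef; congr (_ *: _).
by rewrite mulNr mulrCA mulrA.
Qed.

Lemma sum_dyads (d : 'rV[C]_n) (M Y : 'M[C]_n) :
  \sum_j d 0 j *: (M *m col j Y *m (col j Y)^T) = M *m Y *m diag_mx d *m Y^T.
Proof.
rewrite -!mulmxA (mulmxA Y) mul_mx_diag.
transitivity (M *m \sum_j d 0 j *: (col j Y *m (col j Y)^T)).
  by rewrite mulmx_sumr; apply: eq_bigr => j _; rewrite -scalemxAr mulmxA.
congr (_ *m _); apply/matrixP => i k; rewrite summxE [RHS]mxE.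
by apply: eq_bigr => j _; rewrite !mxE big_ord1 !mxE mulrCA mulrA.
Qed.

(** The single sum is the product - J Y diag(c) Y^T, where Y has the columns y_j;
the c_j do not vanish because no - l_j is an eigenvalue. *)
Lemma riccati_sol_unit : riccati_sol \in unitmx.
Proof.
have [Vunit Hunit] := vander_hankel_unit.
pose Y : 'M[C]_n := - (H *m vander).
have Yunit : Y \in unitmx.
  by rewrite /Y -scaleN1r unitmxZ ?unitrN1 // unitmx_mul Hunit.
have yE j : yvec A (lambda j) = col j Y.
  by rewrite yvec_upper_hankel ?lambda_neq0 // /Y !colE mulNmx -mulmxA -colE col_vander.
have -> : riccati_sol = from_canonical A b
    (J *m Y *m diag_mx (\row_j - residue (lambda j)) *m Y^T).
  rewrite -sum_dyads; congr from_canonical; apply: eq_bigr => j _.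
  by rewrite yE mxE.
rewrite from_canonicalE !unitmx_mul !unitmx_tr !unitmx_mul !unitmx_inv.
rewrite !unitmx_tr unitmx_inv.
rewrite ctrb_unit Hunit Yunit !andbT /=.
rewrite !unitmxE !det_diag !unitfE.
apply/andP; split; apply/prodf_neq0 => j _; rewrite mxE.
  by rewrite expf_neq0 // oppr_eq0 oner_eq0.
by rewrite oppr_eq0 mulf_neq0 ?char_polyN_neq0 // invr_eq0 deriv_char_poly_neq0.
Qed.

(** As u_j^T b = - 1, the coefficient of u_i in X b is c_i times
sum_j c_j / (l_j + l_i).  This sum is evaluated by the last coordinate of the
expansion of J y_i, because the last coordinate of each y is - 1. *)
Lemma riccati_sol_b :
  riccati_sol *m b = (-1) ^+ n *: \sum_i residue (lambda i) *: lefteig (lambda i).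
Proof.
rewrite riccati_sol_pairs mulmx_suml scaler_sumr; apply: eq_bigr => i _.
have last_yvec l : root N l -> l != 0 -> yvec A l ord_max 0 = -1.
  move=> Nl l0; have sizeN : (size N <= n.+1)%N by rewrite size_char_poly.
  rewrite yvec_upper_hankel // mxE upper_hankel_xvec //.
  have /monicP := char_poly_monic A; rewrite /lead_coef size_char_poly /= => lead1.
  by rewrite horner_drop_polyS drop_poly_eq0 // horner0 mul0r addr0 lead1.
have sum_cauchy : \sum_j residue (lambda j) / (lambda j + lambda i) = (-1) ^+ n.
  have := yvec_expansion (rootN i) => /(congr1 (fun M : 'cV[C]_n => M ord_max 0)).
  rewrite mul_diag_mx summxE [RHS]mxE [X in X * _]mxE last_yvec ?lambda_neq0 //=.
  rewrite exprS mulN1r mulrNN mulr1 => <-; rewrite -sumrN.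
  by apply: eq_bigr => j _; rewrite mxE last_yvec ?lambda_neq0 // mulrN1 opprK.
rewrite scalerA -sum_cauchy mulr_suml scaler_suml mulmx_suml; apply: eq_bigr => j _.
rewrite -scalemxAl -mulmxA lefteig_b mul_mx_scalar scaleN1r.
rewrite scalerN -scaleNr /pair_coef opprK.
by rewrite [lambda i + _]addrC [residue (lambda i) * _]mulrC mulrAC.
Qed.

Hypothesis A_real : map_mx Num.conj A = A.

(** The factor l_i + l_j which the Lyapunov operator produces on the dyad
u_i u_j^T cancels the denominator of its coefficient, so the left-hand side
factors as - w w^T; the sign in X b = (-1)^n w disappears in (X b) (X b)^T. *)
Lemma riccati_solP : riccati A b riccati_sol.
Proof.
have AtE : A ^t* = A^T by rewrite -map_trmx A_real.
have symX : riccati_sol^T = riccati_sol.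
  rewrite riccati_sol_pairs [in RHS]exchange_big linear_sum; apply: eq_bigr => i _ /=.
  rewrite linear_sum; apply: eq_bigr => j _ /=.
  by rewrite linearZ /= trmx_mul trmxK pair_coefC.
have bX : b^T *m riccati_sol = (riccati_sol *m b)^T by rewrite trmx_mul symX.
rewrite /riccati AtE -(mulmxA _ b^T) bX riccati_sol_b linearZ /= -scalemxAl -scalemxAr.
rewrite scalerA -exprMn mulrNN mulr1 expr1n scale1r.
rewrite riccati_sol_pairs mulmx_suml mulmx_sumr mulmx_suml -sumrN -big_split.
apply: eq_bigr => i _ /=.
rewrite [(\sum_i _ *: _)^T]linear_sum !(mulmx_suml, mulmx_sumr) -sumrN -big_split.
apply: eq_bigr => j _ /=.
have := ctrb_lefteig (rootN i) => /(congr1 trmx).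
rewrite linearZ /= trmx_mul !trmxK => Au.
rewrite [(residue _ *: _)^T]linearZ /= -!scalemxAl -!scalemxAr.
rewrite mulmxA Au -mulmxA ctrb_lefteig //.
rewrite -!scalemxAl -scalemxAr !scalerA -scalerDl -scaleNr; congr (_ *: _).
by rewrite /pair_coef; have := sum_neq0 i j; move: (lambda i) (lambda j) => l m lm; field.
Qed.

(** Multiplying the equation on both sides by X^-1 makes it linear:
A X^-1 + X^-1 A^T = - b b^T.  Between two left eigenvectors this is a scalar
equation with the nonzero factor l_i + l_j. *)
Lemma lyapunov_entry X i j : X \in unitmx -> riccati A b X ->
  ((lefteig (lambda i))^T *m invmx X *m lefteig (lambda j)) 0 0 =
  - (lambda i + lambda j)^-1.
Proof.
move=> Xunit; rewrite /riccati -map_trmx A_real => ricX.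
have lyap : A *m invmx X + invmx X *m A^T = - (b *m b^T).
  have := congr1 (fun M => invmx X *m M *m invmx X) ricX.
  rewrite mulmxDr mulmxDl mulKmx // (mulmxA _ A^T) mulmxK // mulmxN mulNmx => ->.
  by rewrite -!mulmxA mulKmx // mulmxV // mulmx1.
have := congr1 (fun M => ((lefteig (lambda i))^T *m M *m lefteig (lambda j)) 0 0) lyap.
have := ctrb_lefteig (rootN j) => /(congr1 trmx).
rewrite linearZ /= trmx_mul !trmxK => Au.
rewrite mulmxDr mulmxDl !mulmxA ctrb_lefteig // -[X in _ + X]mulmxA Au.
rewrite -scalemxAr -!scalemxAl -scalerDl.
have -> : (lefteig (lambda i))^T *m - (b *m b^T) *m lefteig (lambda j) = (-1)%:M.
  have bu : b^T *m lefteig (lambda j) = (-1)%:M.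
    by rewrite -(tr_scalar_mx _ (-1)) -(lefteig_b (lambda j)) trmx_mul trmxK.
  rewrite (mulmxN _ (b *m b^T)) mulNmx mulmxA -mulmxA lefteig_b bu -scalar_mxM.
  by rewrite mulrNN mulr1 raddfN.
rewrite mxE [in X in _ = X -> _]mxE mulr1n => /(canRL (mulKf (sum_neq0 i j))) ->.
by rewrite mulrN1.
Qed.

Lemma riccati_sol_unique X : X \in unitmx -> riccati A b X -> riccati_sol = X.
Proof.
move=> Xunit Xric; apply: (can_inj (@invmxK _ _)).
have [Vunit Hunit] := vander_hankel_unit.
pose U : 'M[C]_n := - ((invmx (ctrb A b))^T *m vander).
have Uunit : U \in unitmx.
  by rewrite /U -scaleN1r unitmxZ ?unitrN1 // unitmx_mul unitmx_tr unitmx_inv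
             ctrb_unit Vunit.
have uE j : lefteig (lambda j) = col j U.
  by rewrite /lefteig /U !colE mulNmx -mulmxA -colE col_vander.
apply: (can_inj (mulmxK Uunit)).
apply: (can_inj (mulKmx (_ : U^T \in unitmx))); first by rewrite unitmx_tr.
apply/matrixP => i j.
have entry M : (U^T *m (M *m U)) i j =
    ((lefteig (lambda i))^T *m M *m lefteig (lambda j)) 0 0.
  by rewrite !uE [LHS]mulmx_entry_col colE -!mulmxA -colE tr_col -row_mul [RHS]mxE.
by rewrite !entry !lyapunov_entry //; [apply: riccati_sol_unit | apply: riccati_solP].
Qed.

Hypothesis b_real : map_mx Num.conj b = b.

(** * The two spectral decompositions *)

(** For a real pair (A, b), taking adjoints preserves the Riccati equation, so
uniqueness applies. *)
Lemma riccati_sol_herm : riccati_sol ^t* = riccati_sol.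
Proof.
symmetry; apply: riccati_sol_unique.
  by rewrite map_unitmx unitmx_tr riccati_sol_unit.
have := riccati_solP; rewrite /riccati (conj_realP A_real).
move=> /(congr1 (fun M : 'M[C]_n => M ^t*)).
rewrite linearD linearN /= map_mxD map_mxN !trmx_mul !trmxK !map_mxM.
by rewrite A_real b_real (conj_realP A_real) (conj_realP b_real) addrC !mulmxA.
Qed.

Lemma from_canonical_herm_part (M : 'M[C]_n) :
  from_canonical A b (herm_part M) = herm_part (from_canonical A b M).
Proof.
rewrite !from_canonicalE herm_part_congr // map_mxM !map_invmx upper_hankel_conj //.
rewrite -map_trmx map_invmx; congr ((invmx _)^T *m _).
by rewrite map_ctrb A_real b_real.
Qed.

Lemma from_canonical_sum (I : finType) (F : I -> 'M[C]_n) :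
  from_canonical A b (\sum_i F i) = \sum_i from_canonical A b (F i).
Proof.
rewrite from_canonicalE mulmx_sumr mulmx_suml; apply: eq_bigr => i _.
by rewrite from_canonicalE.
Qed.

Lemma riccati_sol_Ptilde :
  riccati_sol = \sum_j from_canonical A b (Ptilde A (lambda j)).
Proof.
rewrite -from_canonical_sum -herm_part_sum from_canonical_herm_part.
rewrite -[LHS](herm_part_id riccati_sol_herm); congr (herm_part (from_canonical _ _ _)).
by apply: eq_bigr => j _; rewrite /residue -mulrN -invrN.
Qed.

Lemma root_conj z : root N z -> root N (z^*)%R.
Proof. by move=> /rootP Nz; apply/rootP; rewrite horner_char_poly_conj // Nz rmorph0. Qed.

(** The conjugate of [yvec_expansion] at mu = conj(l_j), which is again an
eigenvalue; this avoids reindexing the spectrum by conjugation. *)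
Lemma conj_yvec_expansion j :
  \sum_i ((residue (lambda i))^* / ((lambda i)^* + lambda j))%R *:
    map_mx Num.conj (yvec A (lambda i)) = J *m yvec A (lambda j).
Proof.
have := yvec_expansion (root_conj (rootN j)) => /(congr1 (map_mx Num.conj)).
rewrite map_mxM alt_diag_conj yvec_conj // conjCK => <-.
rewrite raddf_sum; apply: eq_bigr => i _ /=.
(* yvec and residue unfold to a scaling and a quotient, which the rewriting
   rules below would match. *)
move: (yvec _ _) (residue _) => y r.
by rewrite map_mxZ fmorph_div rmorphD /= conjCK.
Qed.

Lemma riccati_sol_Ppair :
  riccati_sol = \sum_i \sum_j from_canonical A b (Ppair A (lambda i) (lambda j)).
Proof.
under eq_bigr => i _ do rewrite -from_canonical_sum -herm_part_sum.
rewrite -from_canonical_sum -herm_part_sum from_canonical_herm_part exchange_big.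
rewrite -[LHS](herm_part_id riccati_sol_herm); congr (herm_part (from_canonical _ _ _)).
apply: eq_bigr => j _; rewrite -conj_yvec_expansion mulmx_suml scaler_sumr.
apply: eq_bigr => i _; rewrite map_trmx trmxK.
move: (map_mx _ _) (yvec A (lambda j)) => p q.
rewrite -scalemxAl !scalerA; congr (_ *: _).
rewrite /residue horner_deriv_char_poly_conj // -rmorphN horner_char_poly_conj //.
rewrite fmorph_div !invfM invrN.
by ring.
Qed.
End Spectrum.

Theorem corollary1 (R : rcfType) (n : nat) (A : 'M[R]_n) (b : 'cV[R]_n)
    (lambda : 'I_n -> R[i]) :
  let Ac : 'M[R[i]]_n := map_mx (real_complex R) A in
  let bc : 'cV[R[i]]_n := map_mx (real_complex R) b in
  injective lambda ->
  (forall z : R[i], eigenvalue Ac z <-> exists j : 'I_n, z = lambda j) ->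
  (forall i j : 'I_n, lambda i + lambda j != 0) ->
  ctrb A b \in unitmx ->
  exists Pinv : 'M[R[i]]_n,
    [/\ unique (fun X : 'M[R[i]]_n => X \in unitmx /\ riccati Ac bc X) Pinv,
        Pinv = \sum_(j < n) from_canonical Ac bc (Ptilde Ac (lambda j)),
        Pinv = \sum_(i < n) \sum_(j < n)
                 from_canonical Ac bc (Ppair Ac (lambda i) (lambda j)),
        (forall j : 'I_n,
           from_canonical Ac bc (Ptilde Ac (lambda j)) \is hermsymmx) &
        (forall i j : 'I_n,
           from_canonical Ac bc (Ppair Ac (lambda i) (lambda j))
             \is hermsymmx)].
Proof.
(* Square matrices form a nontrivial ring only in positive dimension. *)
case: n A b lambda => [|n] A b lambda Ac bc lambda_inj spec sum_neq0 ctrb_unit.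
  exists 0; split; rewrite ?big_ord0 //; try by case.
  split=> [|X _]; last by rewrite [X]flatmx0.
  by rewrite unitmxE det_mx00 unitr1 /riccati; split=> //; apply/matrixP; case.
have rootE z : root (char_poly Ac) z <-> exists j, z = lambda j.
  by rewrite -spec eigenvalue_root_char.
have Areal : map_mx Num.conj Ac = Ac.
  by apply/matrixP => i j; rewrite !mxE; apply: conjc_real.
have breal : map_mx Num.conj bc = bc.
  by apply/matrixP => i j; rewrite !mxE; apply: conjc_real.
have cunit : ctrb Ac bc \in unitmx.
  by rewrite -map_ctrb map_unitmx.
exists (riccati_sol Ac bc lambda); split.
- split; first by split; [apply: riccati_sol_unit | apply: riccati_solP].
  by move=> X [Xunit Xric]; apply: riccati_sol_unique.
- exact: riccati_sol_Ptilde.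
- exact: riccati_sol_Ppair.
- by move=> j; rewrite from_canonical_herm_part // herm_part_hermsym.
- by move=> i j; rewrite from_canonical_herm_part // herm_part_hermsym.
Qed.
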